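(* Let $(X,d)$ be a quasi-metric space. Then the following are equivalent: (1) $(X,d)$ is a continuous $\mathbb{J}$-algebra. (2) $(X,d)$ is standard and the partially ordered set $(\mathrm{B}X,\sqsubseteq)$ of formal balls of $(X,d)$ is a local domain. In this case, the $\mathcal{J}$-below distributor $\mathfrak{w}$ of $(X,d)$ and the way below relation $\ll$ of $(\mathrm{B}X,\sqsubseteq)$ determine each other via $$(x,r)\ll(y,s)\quad\text{if and only if}\quad r>s+\mathfrak{w}(x,y)$$ for all $x,y\in X$ and $r,s<\infty$ (i.e. $r,s\in[0,\infty)$).
   Context: A quasi-metric space is a set $X$ with a map $d\colon X\times X\to[0,\infty]$ such that $d(x,x)=0$, $d(x,y)+d(y,z)\ge d(x,z)$, and $d(x,y)=d(y,x)=0$ implies $x=y$. Here $a\ominus b=\max\{0,a-b\}$ for $a,b\in[0,\infty]$, with $a\ominus\infty=0$ for all $a$ (including $a=\infty$) and $\infty\ominus b=\infty$ for $b<\infty$. A map $f\colon(X,d_X)\to(Y,d_Y)$ is non-expansive if $d_X(x,y)\ge d_Y(f(x),f(y))$ for all $x,y$. For non-expansive $f\colon X\to Y$ and $g\colon Y\to X$, $f$ is left adjoint to $g$ ($f\dashv g$) if $d_Y(f(x),y)=d_X(x,g(y))$ for all $x\in X$, $y\in Y$. Formal balls: a formal ball of $(X,d)$ is a pair $(x,r)\in X\times[0,\infty)$; the set $\mathrm{B}X$ of formal balls is partially ordered by $(x,r)\sqsubseteq(y,s)$ iff $d(x,y)\le r-s$. A directed subset of $\mathrm{B}X$ is written as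 a net $\{(x_i,r_i)\}_{i\in D}$ indexed by itself, with $i\le j$ iff $(x_i,r_i)\sqsubseteq(x_j,r_j)$. Joins are least upper bounds. A net $\{x_i\}_{i\in D}$ in $X$ is forward Cauchy if $\inf_{i}\sup_{k\ge j\ge i}d(x_j,x_k)=0$; $x\in X$ is a Yoneda limit of it if $d(x,y)=\inf_{i}\sup_{j\ge i}d(x_j,y)$ for all $y\in X$. $(X,d)$ is standard if whenever a directed set $\{(x_i,r_i)\}_{i\in D}$ of $\mathrm{B}X$ has a join, the (automatically forward Cauchy) net $\{x_i\}_{i\in D}$ has a Yoneda limit. In a partially ordered set $P$, $x\ll y$ ($x$ is way below $y$) if for each directed set $E\subseteq P$ having a join with $y\sqsubseteq\bigvee E$, there is $e\in E$ with $x\sqsubseteq e$. $P$ is a continuous poset if for each $y\in P$ the set $\{x\mid x\ll y\}$ is directed and has $y$ as a join. $P$ is a local dcpo if each directed set of $P$ with an upper bound has a join. A local domain is a partially ordered set that is both a continuous poset and a local dcpo (no bottom element is required). Weights: a weight of $(X,d)$ is a map $\phi\colon X\to[0,\infty]$ with $\phi(y)+d(x,y)\ge\phi(x)$ for all $x,y$. $\mathcal{P}X$ is the set of weights with the quasi-metric $\rho_X(\phi,\psi)=\sup_{x\in X}\psi(x)\ominus\phi(x)$. A weight $\phi$ is an ideal if $\inf_{x}\phi(x)=0$ and $\rho_X(\phi,\lambda\wedge\mu)=\min\{\rho_X(\phi,\lambda),\rho_X(\phi,\mu)\}$ for all $\lambda,\mu\in\mathcal{P}X$ (with $\lambda\wedge\mu$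 the pointwise minimum). A weight $\phi$ is bounded if there are $a\in X$, $r<\infty$ with $r+\phi\ge d(-,a)$ pointwise. A bounded ideal is a weight that is both bounded and an ideal; $\mathcal{J}X\subseteq\mathcal{P}X$ is the subspace of bounded ideals. An element $b\in X$ is a colimit of a weight $\phi$, written $b=\operatorname{colim}\phi$, if $d(b,x)=\rho_X(\phi,d(-,x))$ for all $x\in X$. $\mathbb{J}$ is the bounded ideal monad on the category of quasi-metric spaces and non-expansive maps, with functor $X\mapsto(\mathcal{J}X,\rho_X)$ and unit $\mathsf{y}_X(x)=d(-,x)$. Since it is a Kock-Zöberlein monad, $(X,d)$ is a $\mathbb{J}$-algebra precisely when every bounded ideal has a colimit, equivalently when $\mathsf{y}_X\colon X\to\mathcal{J}X$ has a left adjoint (which is then $\operatorname{colim}\colon\mathcal{J}X\to X$); this may be taken as the definition. A $\mathbb{J}$-algebra $(X,d)$ is continuous if $\operatorname{colim}\colon(\mathcal{J}X,\rho_X)\to(X,d)$ itself has a left adjoint. The $\mathcal{J}$-below distributor of a $\mathbb{J}$-algebra $(X,d)$ is the map $\mathfrak{w}\colon X\times X\to[0,\infty]$, $\mathfrak{w}(x,y)=\sup_{\phi\in\mathcal{J}X}\bigl(\phi(x)\ominus d(y,\operatorname{colim}\phi)\bigr)$. *)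

(* Defs.v *)
From HB Require Import structures.
From mathcomp Require Import all_boot all_order all_algebra.
From mathcomp Require Import all_classical all_reals ereal.

Set Implicit Arguments.
Unset Strict Implicit.
Unset Printing Implicit Defensive.

Import Order.TTheory GRing.Theory Num.Theory.

Local Open Scope classical_set_scope.
Local Open Scope ring_scope.
Local Open Scope ereal_scope.

(* In [\bar R] one has [+oo - +oo = -oo], so [maxe 0] gives the conventions
   [a (-) +oo = 0] for all [a], and [+oo (-) b = +oo] for [b < +oo]. *)
Definition tsube (R : realType) (a b : \bar R) : \bar R := maxe 0 (a - b).

(* Supremum computed in [0, +oo]: the supremum of the empty family is [0],
   whereas [ereal_sup set0 = -oo]. *)
Definition sup_ge0 (R : realType) (I : Type) (D : set I) (f : I -> \bar R) :
  \bar R := ereal_sup (0 |` (f @` D)).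

Section ExtendedReals.
Variable R : realType.
Implicit Types a b c : \bar R.

Lemma tsube_ge0 a b : 0 <= tsube a b.
Proof. by rewrite /tsube le_max lexx. Qed.

Lemma tsube_le a b c : 0 <= b -> 0 <= c -> (tsube a b <= c) = (a <= c + b).
Proof.
move=> b0 c0; rewrite /tsube ge_max c0 /=.
case: b b0 => [r _||//]; first by rewrite leeBlDr.
by case: c c0 => // [r|] _ _; case: a => //= *; rewrite ?leNye ?leey.
Qed.

Lemma sup_ge0_ge0 I (D : set I) (f : I -> \bar R) : 0 <= sup_ge0 D f.
Proof. by apply: ereal_sup_ubound; left. Qed.

Lemma le_sup_ge0 I (D : set I) (f : I -> \bar R) i : D i -> f i <= sup_ge0 D f.
Proof. by move=> Di; apply: ereal_sup_ubound; right; exists i. Qed.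

Lemma sup_ge0_le I (D : set I) (f : I -> \bar R) c :
  0 <= c -> (forall i, D i -> f i <= c) -> sup_ge0 D f <= c.
Proof.
by move=> c0 fc; apply: ge_ereal_sup => _ [->//|[i Di <-]]; exact: fc.
Qed.

End ExtendedReals.

HB.mixin Record isQuasiMetric (R : realType) (X : Type) := {
  qdist : X -> X -> \bar R ;
  qdist_ge0 : forall x y, 0 <= qdist x y ;
  qdistxx : forall x, qdist x x = 0 ;
  qdist_triangle : forall x y z, qdist x z <= qdist x y + qdist y z ;
  qdist_sep : forall x y, qdist x y = 0 -> qdist y x = 0 -> x = y
}.

#[short(type="quasiMetricType")]
HB.structure Definition QuasiMetric (R : realType) := {X of isQuasiMetric R X}.

Definition nonexpansive (R : realType) (X Y : quasiMetricType R) (f : X -> Y) :=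
  forall x y, qdist (f x) (f y) <= qdist x y.

Definition left_adjoint (R : realType) (X Y : quasiMetricType R)
    (f : X -> Y) (g : Y -> X) :=
  [/\ nonexpansive f, nonexpansive g &
      forall x y, qdist (f x) y = qdist x (g y)].

Section Posets.
Context (disp : Order.disp_t) (P : porderType disp).
Implicit Types (x y : P) (E : set P).

Definition directed_set E :=
  E !=set0 /\ forall x y, E x -> E y -> exists z, [/\ E z, (x <= z)%O & (y <= z)%O].

Definition way_below x y := forall E z,
  directed_set E -> supremums E z -> (y <= z)%O -> exists2 e, E e & (x <= e)%O.

Definition continuous_poset := forall y,
  directed_set [set x | way_below x y] /\ supremums [set x | way_below x y] y.

Definition local_dcpo := forall E,
  directed_set E -> has_ubound E -> supremums E !=set0.

Definition local_domain := continuous_poset /\ local_dcpo.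

End Posets.
Arguments continuous_poset {disp} P.
Arguments local_dcpo {disp} P.
Arguments local_domain {disp} P.

(* A net is a map on a poset [I] restricted to a directed subset [D]. *)
Section Nets.
Context (R : realType) (X : quasiMetricType R).
Context (disp : Order.disp_t) (I : porderType disp) (D : set I) (u : I -> X).

Definition forward_cauchy :=
  ereal_inf [set sup_ge0 [set jk : I * I | [/\ D jk.1, D jk.2 &
                                             (i <= jk.1 <= jk.2)%O]]
                         (fun jk => qdist (u jk.1) (u jk.2)) | i in D] = 0.

Definition yoneda_limit (a : X) := forall y,
  qdist a y =
  ereal_inf [set sup_ge0 [set j | D j /\ (i <= j)%O]
                         (fun j => qdist (u j) y) | i in D].

End Nets.

Record formal_ball (R : realType) (X : quasiMetricType R) := FormalBall {
  center : X ;
  radius : {nonneg R}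
}.

Section FormalBalls.
Context (R : realType) (X : quasiMetricType R).
Implicit Types a b c : formal_ball X.

HB.instance Definition _ := gen_eqMixin (formal_ball X).
HB.instance Definition _ := gen_choiceMixin (formal_ball X).

Definition fball_le a b : bool :=
  qdist (center a) (center b) <= ((radius a)%:num - (radius b)%:num)%:E.

Lemma fball_le_refl : reflexive fball_le.
Proof. by move=> a; rewrite /fball_le qdistxx subrr. Qed.

Lemma fball_le_anti : antisymmetric fball_le.
Proof.
move=> [x r] [y s] /andP[]; rewrite /fball_le /= => xy yx.
have sr : (s%:num <= r%:num)%R.
  by rewrite -subr_ge0 -lee_fin (le_trans _ xy)// qdist_ge0.
have rs : (r%:num <= s%:num)%R.
  by rewrite -subr_ge0 -lee_fin (le_trans _ yx)// qdist_ge0.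
have e : r%:num%R = s%:num%R by apply/eqP; rewrite eq_le rs.
move: xy yx; rewrite e subrr => xy yx.
rewrite (_ : r = s); last exact: val_inj.
by rewrite (qdist_sep x y)//; apply/eqP; rewrite eq_le qdist_ge0 ?xy ?yx.
Qed.

Lemma fball_le_trans : transitive fball_le.
Proof.
move=> b a c ab bc; rewrite /fball_le.
apply: (le_trans (qdist_triangle _ (center b) _)).
apply: (le_trans (leeD ab bc)).
by rewrite -EFinD lee_fin addrA subrK.
Qed.

Fact formal_ball_display : Order.disp_t. Proof. exact: Order.default_display. Qed.

HB.instance Definition _ := Order.Le_isPOrder.Build formal_ball_display
  (formal_ball X) fball_le_refl fball_le_anti fball_le_trans.

Lemma fball_leE a b : (a <= b)%O =
  (qdist (center a) (center b) <= ((radius a)%:num - (radius b)%:num)%:E).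
Proof. by []. Qed.

Lemma directed_forward_cauchy (E : set (formal_ball X)) :
  directed_set E -> forward_cauchy E (@center R X).
Proof.
move=> [E0 _]; apply/eqP; rewrite eq_le; apply/andP; split; last first.
  by apply: le_ereal_inf_tmp => _ [i Ei <-]; exact: sup_ge0_ge0.
pose rad := [set (radius i)%:num%R | i in E].
have rad_inf : has_inf rad.
  split; first by case: E0 => i Ei; exists (radius i)%:num%R, i.
  by exists 0%R => _ [i _ <-].
apply/lee_addgt0Pr => e e0; rewrite add0e.
have [_ [i Ei <-] ie] := inf_adherent e0 rad_inf.
apply: ge_ereal_inf; exists (sup_ge0 [set jk : formal_ball X * formal_ball X |
  [/\ E jk.1, E jk.2 & (i <= jk.1 <= jk.2)%O]]
  (fun jk => qdist (center jk.1) (center jk.2))); first by exists i.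
apply: sup_ge0_le => [|[j k] /= [Ej Ek]]; first by rewrite lee_fin ltW.
rewrite !fball_leE => /andP[ij jk].
have ji : ((radius j)%:num <= (radius i)%:num)%R.
  by rewrite -subr_ge0 -lee_fin (le_trans _ ij)// qdist_ge0.
have ki : (inf rad <= (radius k)%:num)%R.
  by apply: ge_inf; [exact: rad_inf.2|exists k].
apply: (le_trans jk); rewrite lee_fin lerBlDl.
by rewrite (le_trans ji)// (le_trans (ltW ie))// lerD2r.
Qed.

End FormalBalls.

(* By [directed_forward_cauchy] the nets below are forward Cauchy. *)
Definition standard (R : realType) (X : quasiMetricType R) :=
  forall E : set (formal_ball X), directed_set E -> supremums E !=set0 ->
  exists a : X, yoneda_limit E (@center R X) a.

Record weight (R : realType) (X : quasiMetricType R) := Weight {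
  weight_fun :> X -> \bar R ;
  weight_ge0 : forall x, 0 <= weight_fun x ;
  weight_le : forall x y, weight_fun x <= weight_fun y + qdist x y
}.

Section Weights.
Context (R : realType) (X : quasiMetricType R).
Implicit Types phi psi lambda mu : weight X.

Lemma weight_inj phi psi : (forall x, phi x = psi x) -> phi = psi.
Proof.
case: phi psi => [f f0 fl] [g g0 gl] /= /funext fg.
by subst g; congr Weight; exact: Prop_irrelevance.
Qed.

Definition rho phi psi : \bar R :=
  sup_ge0 [set: X] (fun x => tsube (psi x) (phi x)).

Lemma rho_ge0 phi psi : 0 <= rho phi psi.
Proof. exact: sup_ge0_ge0. Qed.

Lemma rho_leP phi psi c :
  0 <= c -> rho phi psi <= c <-> forall x, psi x <= c + phi x.
Proof.
move=> c0; split=> [h x|h].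
  rewrite -tsube_le ?weight_ge0//; apply: le_trans h.
  exact: (@le_sup_ge0 _ _ _ (fun x => tsube (psi x) (phi x))).
by apply: sup_ge0_le => // x _; rewrite tsube_le ?weight_ge0.
Qed.

Lemma rhoxx phi : rho phi phi = 0.
Proof.
apply/eqP; rewrite eq_le rho_ge0 andbT.
by apply/rho_leP => // x; rewrite add0e.
Qed.

Lemma rho_triangle phi psi lambda :
  rho phi lambda <= rho phi psi + rho psi lambda.
Proof.
apply/rho_leP => [|x]; first by rewrite adde_ge0 ?rho_ge0.
have /rho_leP h1 := lexx (rho phi psi).
have /rho_leP h2 := lexx (rho psi lambda).
apply: (le_trans (h2 (rho_ge0 _ _) x)).
apply: (le_trans (leeD2l _ (h1 (rho_ge0 _ _) x))).
by rewrite addeA (addeC (rho psi lambda)).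
Qed.

Lemma rho_sep phi psi : rho phi psi = 0 -> rho psi phi = 0 -> phi = psi.
Proof.
move=> h1 h2; apply: weight_inj => x; apply/eqP; rewrite eq_le.
have /rho_leP h1' : rho phi psi <= 0 by rewrite h1.
have /rho_leP h2' : rho psi phi <= 0 by rewrite h2.
by rewrite -[leRHS]add0e h2'//= -[leRHS]add0e h1'.
Qed.

HB.instance Definition _ := isQuasiMetric.Build R (weight X)
  rho_ge0 rhoxx rho_triangle rho_sep.

Lemma weight_min_ge0 lambda mu x : 0 <= mine (lambda x) (mu x).
Proof. by rewrite le_min !weight_ge0. Qed.

Lemma weight_min_le lambda mu x y :
  mine (lambda x) (mu x) <= mine (lambda y) (mu y) + qdist x y.
Proof.
by rewrite ge_min; case: (leP (lambda y) (mu y)) => _; rewrite weight_le ?orbT.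
Qed.

Definition weight_min lambda mu : weight X :=
  Weight (weight_min_ge0 lambda mu) (weight_min_le lambda mu).

Lemma yoneda_ge0 (a x : X) : 0 <= qdist x a.
Proof. exact: qdist_ge0. Qed.

Lemma yoneda_le (a x y : X) : qdist x a <= qdist y a + qdist x y.
Proof. by rewrite addeC qdist_triangle. Qed.

Definition yoneda (a : X) : weight X := Weight (yoneda_ge0 a) (yoneda_le a).

Definition ideal phi :=
  ereal_inf (range phi) = 0 /\
  forall lambda mu : weight X,
    qdist phi (weight_min lambda mu) = mine (qdist phi lambda) (qdist phi mu).

Definition bounded_weight phi :=
  exists (a : X) (r : {nonneg R}), forall x, qdist x a <= r%:num%:E + phi x.

Definition is_colim phi (b : X) := forall x, qdist b x = qdist phi (yoneda x).

Lemma is_colim_unique phi b b' : is_colim phi b -> is_colim phi b' -> b = b'.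
Proof.
by move=> hb hb'; apply: qdist_sep; [rewrite hb -hb'|rewrite hb' -hb];
  exact: qdistxx.
Qed.

End Weights.

Record bounded_ideal (R : realType) (X : quasiMetricType R) := BoundedIdeal {
  bideal_weight :> weight X ;
  bideal_ideal : ideal bideal_weight ;
  bideal_bounded : bounded_weight bideal_weight
}.

Section BoundedIdeals.
Context (R : realType) (X : quasiMetricType R).
Implicit Types phi psi : bounded_ideal X.

Definition bideal_dist phi psi := qdist (phi : weight X) (psi : weight X).

Lemma bideal_dist_ge0 phi psi : 0 <= bideal_dist phi psi.
Proof. exact: qdist_ge0. Qed.

Lemma bideal_distxx phi : bideal_dist phi phi = 0.
Proof. exact: qdistxx. Qed.

Lemma bideal_dist_triangle phi psi lambda :
  bideal_dist phi lambda <= bideal_dist phi psi + bideal_dist psi lambda.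
Proof. exact: qdist_triangle. Qed.

Lemma bideal_dist_sep phi psi :
  bideal_dist phi psi = 0 -> bideal_dist psi phi = 0 -> phi = psi.
Proof.
case: phi psi => [f fi fb] [g gi gb] /= h1 h2.
have fg : f = g by exact: qdist_sep.
by subst g; congr BoundedIdeal; exact: Prop_irrelevance.
Qed.

HB.instance Definition _ := isQuasiMetric.Build R (bounded_ideal X)
  bideal_dist_ge0 bideal_distxx bideal_dist_triangle bideal_dist_sep.

End BoundedIdeals.

(* Algebras of the Kock-Zoberlein monad of bounded ideals. *)
Definition J_algebra (R : realType) (X : quasiMetricType R) :=
  forall phi : bounded_ideal X, exists b : X, is_colim phi b.

(* The choice is immaterial by [is_colim_unique]. *)
Definition colim (R : realType) (X : quasiMetricType R) (hX : J_algebra X)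
  (phi : bounded_ideal X) : X := sval (cid (hX phi)).

Definition continuous_J_algebra (R : realType) (X : quasiMetricType R) :=
  exists (hX : J_algebra X) (t : X -> bounded_ideal X),
    left_adjoint t (colim hX).

Definition J_below (R : realType) (X : quasiMetricType R) (hX : J_algebra X)
    (x y : X) : \bar R :=
  sup_ge0 [set: bounded_ideal X]
    (fun phi => tsube (phi x) (qdist y (colim hX phi))).

(* Main.v *)
Require Import Defs.
From HB Require Import structures.
From mathcomp Require Import all_boot all_order all_algebra.
From mathcomp Require Import all_classical all_reals ereal.
From mathcomp Require Import interval_inference lra.

(** Everything rests on a correspondence between directed sets of formal balls
    and ideals. A directed set [E] whose radii have infimum [r] generates the
    weight [phi x = inf_(e in E) d(x, center e) + radius e - r], which is an
    ideal ([directed_generates], [generates_ideal]); conversely an ideal [phi]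
    is generated by the balls [(x, s)] with [h + phi x < s], whatever the
    radius [h >= 0] ([ideal_generates]). Under this correspondence a Yoneda
    limit of the centers of [E] is the same thing as a colimit of [phi]
    ([generates_yoneda_limit]), an upper bound of [E] makes [phi] bounded
    ([generates_bounded]), and if [b] is a colimit of [phi] then [(b, r)] is
    the join of [E] ([generates_supremum]). Hence every bounded ideal has a
    colimit iff [X] is standard and its formal balls form a local dcpo.

    Now let every bounded ideal have a colimit; the joins of directed sets are then
    exactly the balls [(colim phi, r)] ([J_algebra_supremum]). If [t] is left adjoint
    to [colim], then [colim (t y) = y], [t y x] is the [J]-below distributor
    at [(x, y)], and the identity [rho (t y) phi = d(y, colim phi)] says that
    the balls [(x, r)] with [r > s + t y x] are those way below [(y, s)]
    ([adjoint_way_below]); as these balls generate [t y], they are directed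
    with join [(y, s)], so the poset of balls is continuous.

    If conversely the poset of balls is continuous, let [t y] be the ideal
    generated by the balls way below [(y, 0)]; its colimit is [y], and since
    [colim] is non-expansive, [d(y, colim psi) <= rho (t y) psi]. For the
    other inequality put [c = d(y, colim psi)]: then [(y, c)] lies below
    [(colim psi, 0)], the join of the balls generating [psi], so a ball
    [(x, r)] way below [(y, 0)] can be compared with [psi] as soon as
    [(x, r + c)] is known to be way below [(y, c)]. This translation
    invariance of the way below relation is [way_below_shift]. *)

Set Implicit Arguments.
Unset Strict Implicit.
Unset Printing Implicit Defensive.

Import Order.TTheory GRing.Theory Num.Theory.

Local Open Scope classical_set_scope.
Local Open Scope ring_scope.
Local Open Scope ereal_scope.

(** * Weights, representable weights and colimits *)

Section Weights.
Context (R : realType) (X : quasiMetricType R).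
Implicit Types (phi psi : weight X) (a e : formal_ball X).

Lemma wdist_leP phi psi (c : \bar R) :
  0 <= c -> qdist phi psi <= c <-> forall x, psi x <= c + phi x.
Proof. exact: rho_leP. Qed.

Lemma wdist_le phi psi x : psi x <= qdist phi psi + phi x.
Proof. by have /wdist_leP := lexx (qdist phi psi); apply; exact: qdist_ge0. Qed.

Lemma wdist_homo phi psi psi' :
  (forall x, psi x <= psi' x) -> qdist phi psi <= qdist phi psi'.
Proof.
move=> le_psi; apply/wdist_leP => [|x]; first exact: qdist_ge0.
exact: le_trans (le_psi x) (wdist_le phi psi' x).
Qed.

Lemma weight_fball_le psi a e : (a <= e)%O ->
  psi (center a) <= psi (center e) + ((radius a)%:num - (radius e)%:num)%:E.
Proof.
rewrite fball_leE => ae; apply: le_trans (weight_le psi _ (center e)) _.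
exact: leeD2l.
Qed.

Lemma le_radius a e : (a <= e)%O -> ((radius e)%:num <= (radius a)%:num)%R.
Proof.
by rewrite fball_leE -subr_ge0 -lee_fin => /(le_trans (qdist_ge0 _ _)).
Qed.

(** By the Yoneda identity [rho (yoneda a) psi = psi a], and evaluation at a
    point preserves minima. *)
Lemma yoneda_ideal (a : X) : ideal (yoneda a).
Proof.
have wdistE psi : qdist (yoneda a) psi = psi a.
  apply/eqP; rewrite eq_le; apply/andP; split.
    by apply/wdist_leP => [|x]; [exact: weight_ge0|exact: weight_le].
  by have := wdist_le (yoneda a) psi a; rewrite /= qdistxx adde0.
split; last by move=> lambda mu; rewrite !wdistE.
apply/eqP; rewrite eq_le; apply/andP; split.
  by apply: ereal_inf_lbound; exists a => //=; rewrite qdistxx.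
by apply: le_ereal_inf_tmp => _ [x _ <-]; exact: qdist_ge0.
Qed.

Lemma yoneda_bounded (a : X) : bounded_weight (yoneda a).
Proof. by exists a, (0%:nng)%R => x /=; rewrite add0e. Qed.

Definition yoneda_bideal (a : X) : bounded_ideal X :=
  BoundedIdeal (yoneda_ideal a) (yoneda_bounded a).

Lemma is_colim_yoneda (a : X) : is_colim (yoneda a) a.
Proof.
move=> x; apply/eqP; rewrite eq_le; apply/andP; split.
  by have := wdist_le (yoneda a) (yoneda x) a; rewrite /= qdistxx adde0.
apply/wdist_leP => [|z]; first exact: qdist_ge0.
by rewrite /= addeC qdist_triangle.
Qed.

Lemma is_colim_wdist0 phi b : is_colim phi b -> qdist phi (yoneda b) = 0.
Proof. by move=> <-; rewrite qdistxx. Qed.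

Lemma is_colim_le phi b x : is_colim phi b -> qdist x b <= phi x.
Proof.
by move=> /is_colim_wdist0 h; have := wdist_le phi (yoneda b) x; rewrite h add0e.
Qed.

End Weights.

(** * Directed sets of formal balls and the ideals they generate *)

Section Generation.
Context (R : realType) (X : quasiMetricType R).
Implicit Types (phi psi : weight X) (a e : formal_ball X).
Implicit Types (E : set (formal_ball X)) (r h : {nonneg R}).

(** The second and third clauses say that [phi x] is the infimum over [E] of
    [d(x, center e) + radius e - r]; given them, the fourth says that [r] is
    the infimum of the radii. Stated as a relation rather than as a function of [E], so
    that it also covers the balls attached to a given ideal, where [phi] comes
    first. *)
Definition generates E r phi :=
  [/\ directed_set E,
      forall e, E e -> phi (center e) <= ((radius e)%:num - r%:num)%:E,
      forall x c, phi x < c%:E -> exists2 e, E e &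
        qdist x (center e) <= (c + r%:num - (radius e)%:num)%:E &
      ereal_inf (range phi) = 0].

Lemma generates_radius_ge E r phi e :
  generates E r phi -> E e -> (r%:num <= (radius e)%:num)%R.
Proof.
move=> [_ A _ _] /A; rewrite -subr_ge0 -lee_fin; apply: le_trans.
exact: weight_ge0.
Qed.

Lemma generates_radius_inf E r phi (d : R) : generates E r phi -> (0 < d)%R ->
  exists2 e, E e & ((radius e)%:num <= r%:num + d)%R.
Proof.
move=> [_ _ B C] d0; have : ereal_inf (range phi) < d%:E by rewrite C lte_fin.
move=> /ereal_inf_lt[_ [x _ <-]] /B[e Ee xe]; exists e => //; move: xe.
by move/(le_trans (qdist_ge0 _ _)); rewrite lee_fin subr_ge0 (addrC d).
Qed.

(** Distances out of [phi] can be tested at the centers: [psi x] is at most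
    [psi (center e) + d(x, center e)], and [phi x] is the infimum of
    [d(x, center e) + radius e - r]. *)
Lemma generates_wdist_leP E r phi psi (c : \bar R) :
  generates E r phi -> 0 <= c ->
  qdist phi psi <= c <->
  forall e, E e -> psi (center e) <= c + ((radius e)%:num - r%:num)%:E.
Proof.
move=> [_ A B _] c0; split.
  move=> /wdist_leP h e Ee; apply: le_trans (h c0 _) _.
  exact/leeD2l/A.
move=> h; apply/wdist_leP => // x.
have := weight_ge0 phi x; case px : (phi x) => [p||]//; last first.
  by rewrite addey ?leey// gt_eqF// (lt_le_trans _ c0).
move=> _; case: c c0 h => [c||]// c0 h; last by rewrite leey.
apply/lee_addgt0Pr => d d0.
have [|e Ee xe] := B x (p + d)%R; first by rewrite px lte_fin ltrDl.
apply: le_trans (weight_le psi x (center e)) _.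
apply: le_trans (leeD (h e Ee) xe) _.
by rewrite -!EFinD lee_fin; lra.
Qed.

(** Distances out of [phi] are upper limits along the net of centers: moving
    up in [E] costs at most the decrease of the radius, and the radii tend to
    [r]. *)
Lemma generates_wdistE E r phi psi : generates E r phi ->
  qdist phi psi = ereal_inf [set sup_ge0 [set j | E j /\ (i <= j)%O]
                              (fun j => psi (center j)) | i in E].
Proof.
move=> g; have [[_ dE] _ _ _] := g; apply/eqP; rewrite eq_le; apply/andP; split.
  apply: le_ereal_inf_tmp => _ [i Ei <-].
  apply/(generates_wdist_leP _ g); first exact: sup_ge0_ge0.
  move=> k Ek; have [j [Ej ij kj]] := dE _ _ Ei Ek.
  apply: le_trans (weight_fball_le psi kj) _.
  apply: leeD; first by apply: (@le_sup_ge0 _ _ _ (fun j => psi (center j))).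
  by rewrite lee_fin; have := generates_radius_ge g Ej; lra.
apply/lee_addgt0Pr => d d0.
have [e Ee ed] := generates_radius_inf g d0.
apply: ge_ereal_inf; eexists; first by exists e.
apply: sup_ge0_le => [|j [Ej ej]].
  by rewrite adde_ge0 ?qdist_ge0// lee_fin ltW.
have /(generates_wdist_leP _ g)/(_ j Ej) := lexx (qdist phi psi).
move=> /(_ (qdist_ge0 _ _))/le_trans; apply; apply: leeD2l.
by rewrite lee_fin; have := le_radius ej; lra.
Qed.

Lemma generates_yoneda_limit E r phi b : generates E r phi ->
  yoneda_limit E (@center R X) b <-> is_colim phi b.
Proof.
by move=> g; split=> h y; rewrite h (generates_wdistE (yoneda y) g).
Qed.

(** A ball [a] is an upper bound of [E] exactly when the distance from [phi] to
    [yoneda (center a)] is at most [r - radius a], and that distance is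
    [d(b, center a)]. *)
Lemma generates_supremum E r phi b : generates E r phi ->
  is_colim phi b -> supremums E (FormalBall b r).
Proof.
move=> g hb; have [[[e0 Ee0] _] A _ _] := g; split.
  move=> e Ee; rewrite fball_leE /=.
  exact: le_trans (is_colim_le _ hb) (A e Ee).
move=> a ua; rewrite fball_leE /= hb.
have ra (d : R) : (0 < d)%R -> ((radius a)%:num <= r%:num + d)%R.
  move=> /(generates_radius_inf g)[e Ee]; apply: le_trans.
  exact/le_radius/ua.
have {}ra : ((radius a)%:num <= r%:num)%R by apply/ler_addgt0Pr => d /ra.
apply/(generates_wdist_leP _ g) => [|e Ee]; first by rewrite lee_fin subr_ge0.
have := ua e Ee; rewrite fball_leE => /le_trans; apply.
by rewrite -EFinD lee_fin; lra.
Qed.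

(** If [lambda] and [mu] both exceed the bound [c] given by the minimum, each
    does so at some center; the excess survives when going up in [E], hence
    both exceed it at a common center, where the minimum does too. *)
Lemma generates_ideal E r phi : generates E r phi -> ideal phi.
Proof.
move=> g; have [[_ dE] _ _ C] := g; split => // lambda mu.
apply/eqP; rewrite eq_le; apply/andP; split.
  by rewrite le_min; apply/andP; split; apply: wdist_homo => x;
    rewrite /= ge_min lexx ?orbT.
set c := qdist phi (weight_min lambda mu).
have c0 : 0 <= c by exact: qdist_ge0.
rewrite ge_min; apply: contrapT => /negP; rewrite negb_or => /andP[hl hm].
have witness psi : ~~ (qdist phi psi <= c) -> exists2 e, E e &
    c + ((radius e)%:num - r%:num)%:E < psi (center e).
  move=> /negP hpsi; apply: contrapT => hn; apply: hpsi.
  apply/(generates_wdist_leP _ g) => // e Ee.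
  by rewrite leNgt; apply/negP => lt_e; apply: hn; exists e.
have [i Ei li] := witness _ hl; have [k Ek mk] := witness _ hm.
have [j [Ej ij kj]] := dE _ _ Ei Ek.
have transport psi e : (e <= j)%O ->
    c + ((radius e)%:num - r%:num)%:E < psi (center e) ->
    c + ((radius j)%:num - r%:num)%:E < psi (center j).
  move=> ej lt_e; rewrite ltNge; apply/negP => le_j.
  move: lt_e; rewrite ltNge => /negP; apply.
  apply: le_trans (weight_fball_le psi ej) _.
  apply: le_trans (leeD2r _ le_j) _.
  by rewrite -addeA leeD2l// -EFinD lee_fin; lra.
have /(generates_wdist_leP _ g)/(_ j Ej) := lexx c.
move=> /(_ c0); rewrite /= ge_min leNgt (transport _ _ ij li)/=.
by rewrite leNgt (transport _ _ kj mk).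
Qed.

Lemma generates_bounded E r phi :
  generates E r phi -> has_ubound E -> bounded_weight phi.
Proof.
move=> g [a ua]; have [[[e0 Ee0] _] _ _ _] := g.
exists (center a), r => x.
have : qdist phi (yoneda (center a)) <= r%:num%:E; last first.
  by move=> /wdist_leP; exact.
apply/(generates_wdist_leP _ g) => // e Ee.
have := ua e Ee; rewrite fball_leE => /le_trans; apply.
by rewrite -EFinD lee_fin; have : (0 <= (radius a)%:num)%R by []; lra.
Qed.

Lemma directed_generates E : directed_set E -> exists r phi, generates E r phi.
Proof.
move=> dE; have [[e0 Ee0] _] := dE.
pose rad := [set (radius e)%:num%R | e in E].
have rad_inf : has_inf rad.
  by split; [exists (radius e0)%:num%R, e0|exists 0%R => _ [e _ <-]].
have le_rad e : E e -> (inf rad <= (radius e)%:num)%R.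
  by move=> Ee; apply: ge_inf; [exact: rad_inf.2|exists e].
have inf0 : (0 <= inf rad)%R.
  by apply: lb_le_inf; [exact: rad_inf.1|move=> _ [e _ <-]].
pose r := NngNum inf0.
pose f x := ereal_inf
  [set qdist x (center e) + ((radius e)%:num - inf rad)%:E | e in E].
have f0 x : 0 <= f x.
  apply: le_ereal_inf_tmp => _ [e Ee <-].
  by rewrite adde_ge0 ?qdist_ge0// lee_fin subr_ge0 le_rad.
have fle x y : f x <= f y + qdist x y.
  case xy : (qdist x y) (qdist_ge0 x y) => [d||]// _; last first.
    by rewrite addey ?leey// gt_eqF// (lt_le_trans _ (f0 y)).
  rewrite -leeBlDr//; apply: le_ereal_inf_tmp => _ [e Ee <-].
  rewrite leeBlDr//; apply: ge_ereal_inf; eexists; first by exists e.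
  by rewrite addeAC leeD2r// addeC -xy qdist_triangle.
have fe e : E e -> f (center e) <= ((radius e)%:num - inf rad)%:E.
  move=> Ee; apply: ge_ereal_inf; eexists; first by exists e.
  by rewrite qdistxx add0e.
exists r, (Weight f0 fle); split => //=.
  move=> x c /ereal_inf_lt[_ [e Ee <-]] lt_c; exists e => //.
  move: lt_c; case: (qdist x (center e)) (qdist_ge0 x (center e)) => // d _.
  by rewrite -EFinD lte_fin lee_fin; lra.
apply/eqP; rewrite eq_le; apply/andP; split.
  apply/lee_addgt0Pr => d d0; rewrite add0e.
  have [_ [e Ee <-] ed] := inf_adherent d0 rad_inf.
  apply: ge_ereal_inf; exists (f (center e)) => //.
  by apply: le_trans (fe _ Ee) _; rewrite lee_fin; lra.
by apply: le_ereal_inf_tmp => _ [x _ <-].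
Qed.

Lemma bounded_directed_generates E : directed_set E -> has_ubound E ->
  exists r (phi : bounded_ideal X), generates E r phi.
Proof.
move=> /directed_generates[r [phi g]] uE.
by exists r, (BoundedIdeal (generates_ideal g) (generates_bounded g uE)).
Qed.

(** The translation by [h] allows the balls of a bounded ideal to have an upper
    bound: [d(-, a) <= h + phi] puts them all below [(a, 0)]. *)
Definition weight_balls phi h : set (formal_ball X) :=
  [set e | h%:num%:E + phi (center e) < (radius e)%:num%:E].

Lemma residual_weight_ge0 (p : R) (x z : X) : 0 <= tsube p%:E (qdist x z).
Proof. exact: tsube_ge0. Qed.

Lemma residual_weight_le (p : R) (x z w : X) :
  tsube p%:E (qdist x z) <= tsube p%:E (qdist x w) + qdist z w.
Proof.
rewrite tsube_le ?qdist_ge0// ?adde_ge0 ?tsube_ge0 ?qdist_ge0//.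
have := lexx (tsube p%:E (qdist x w)).
rewrite tsube_le ?qdist_ge0 ?tsube_ge0// => /le_trans; apply.
by rewrite -addeA leeD2l// addeC qdist_triangle.
Qed.

(** The value at [z] is the largest radius a ball centered at [z] may have
    while lying above the ball [(x, p)], and [0] if there is no such ball. *)
Definition residual_weight (p : R) (x : X) : weight X :=
  Weight (residual_weight_ge0 p x) (residual_weight_le p x).

(** Directedness is where ideals are used. For two balls of the set, the
    residual weights of both exceed [phi] somewhere; as [phi] is an ideal, so
    does their minimum, at some [z], and the minimum bounds the radius of a
    common upper bound centered at [z]. *)
Lemma ideal_generates phi h : ideal phi -> generates (weight_balls phi h) h phi.
Proof.
move=> [inf0 minE].
have ballP x (c : R) : phi x < c%:E -> exists2 e,
    weight_balls phi h e & center e = x /\ ((radius e)%:num = c + h%:num)%R.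
  move=> xc; have c0 : (0 <= c)%R.
    by rewrite -lee_fin (le_trans (weight_ge0 phi x))// ltW.
  have ch0 : (0 <= c + h%:num)%R by rewrite addr_ge0.
  exists (FormalBall x (NngNum ch0)) => //=.
  by rewrite /weight_balls /= EFinD (addeC c%:E) lteD2lE.
split => //.
- split.
    have : ereal_inf (range phi) < 1%:E by rewrite inf0 lte_fin.
    by move=> /ereal_inf_lt[_ [x _ <-]] /ballP[e]; exists e.
  move=> a b Ba Bb.
  pose p e := ((radius e)%:num - h%:num)%R.
  pose res e := residual_weight (p e) (center e).
  have res_gt0 e : weight_balls phi h e -> 0 < qdist phi (res e).
    rewrite /weight_balls /= => Be; rewrite ltNge; apply/negP => /wdist_leP.
    move=> /(_ (lexx _) (center e)); rewrite add0e /= qdistxx /tsube sube0.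
    rewrite ge_max => /andP[_]; apply/negP; rewrite -ltNge /p.
    by rewrite EFinB lteBrDl ?lte_fin.
  have : ~ qdist phi (weight_min (res a) (res b)) <= 0.
    by rewrite minE; apply/negP; rewrite -ltNge lt_min !res_gt0.
  move=> not_le; have [z lt_z] : exists z, phi z < mine (res a z) (res b z).
    apply: contrapT => no_z; apply: not_le; apply/wdist_leP => // z.
    by rewrite add0e leNgt; apply/negP => lt_z; apply: no_z; exists z.
  move: lt_z; have := weight_ge0 phi z.
  case pz : (phi z) => [q||]; [|by rewrite lt_min !ltNge !leey|by []].
  rewrite lee_fin lt_min => q0 /andP[qa qb].
  have room e : q%:E < res e z ->
      exists2 d, qdist (center e) z = d%:E & (q < p e - d)%R.
    rewrite /= /tsube lt_max lte_fin [(q < 0)%R]ltNge q0 /=.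
    have := qdist_ge0 (center e) z.
    case: (qdist (center e) z) => [d||]// _.
    by rewrite -EFinB lte_fin; exists d.
  have [da zda qda] := room _ qa; have [db zdb qdb] := room _ qb.
  have [|e Be [ez re]] := ballP z (Num.min (p a - da) (p b - db))%R.
    by rewrite pz lte_fin lt_min qda.
  exists e; split => //; rewrite fball_leE ez re ?zda ?zdb lee_fin.
    by rewrite lerBrDr -lerBrDl -lerBrDr ge_min /p; apply/orP; left; lra.
  by rewrite lerBrDr -lerBrDl -lerBrDr ge_min /p; apply/orP; right; lra.
- by move=> e lt_e; rewrite EFinB leeBrDl// ltW.
- by move=> x c /ballP[e Be [ex re]]; exists e => //; rewrite ex qdistxx re subrr.
Qed.

Lemma weight_balls_bounded phi (a : X) h :
  (forall x, qdist x a <= h%:num%:E + phi x) -> has_ubound (weight_balls phi h).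
Proof.
move=> ha; exists (FormalBall a (0%:nng)%R) => e lt_e.
by rewrite fball_leE /= subr0 (le_trans (ha _))// ltW.
Qed.

End Generation.

(** * Colimits of bounded ideals and joins of formal balls *)

Section Algebras.
Context (R : realType) (X : quasiMetricType R).
Implicit Types (phi psi : bounded_ideal X) (a b e : formal_ball X).
Implicit Types (E : set (formal_ball X)) (r s h : {nonneg R}).

(** The colimit of the ideal generated by [E] provides a join of [E], and joins
    are unique: so every join is computed by a colimit. *)
Lemma J_algebra_supremum E b : J_algebra X -> directed_set E ->
  supremums E b -> exists2 phi : bounded_ideal X,
    generates E (radius b) phi & is_colim phi (center b).
Proof.
move=> hX dE sb; have [||r [phi g]] := @bounded_directed_generates _ _ E.
- exact: dE.
- by exists b; exact: sb.1.
have [c hc] := hX phi.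
have := is_subset1_supremums sb (generates_supremum g hc) => ->.
by exists phi.
Qed.

Lemma J_algebra_local_dcpo : J_algebra X -> local_dcpo (formal_ball X).
Proof.
move=> hX E dE uE; have [r [phi g]] := bounded_directed_generates dE uE.
have [b hb] := hX phi.
by exists (FormalBall b r); exact: generates_supremum g hb.
Qed.

Lemma J_algebra_standard : J_algebra X -> standard X.
Proof.
move=> hX E dE [b sb]; have [phi g hb] := J_algebra_supremum hX dE sb.
by exists (center b); apply/(generates_yoneda_limit _ g).
Qed.

(** The balls of a bounded ideal, with radii enlarged by its bound, have an
    upper bound and hence a join; the Yoneda limit of their centers is the
    colimit. *)
Lemma standard_J_algebra :
  standard X -> local_dcpo (formal_ball X) -> J_algebra X.
Proof.
move=> sX lX phi; have [a [h ha]] := bideal_bounded phi.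
have g := ideal_generates h (bideal_ideal phi); have [dE _ _ _] := g.
have [b /(generates_yoneda_limit _ g) hb] :=
  sX _ dE (lX _ dE (weight_balls_bounded ha)).
by exists b.
Qed.

Lemma colimP (hX : J_algebra X) phi : is_colim phi (colim hX phi).
Proof. by rewrite /colim; case: cid. Qed.

Lemma colim_yoneda (hX : J_algebra X) (x : X) : colim hX (yoneda_bideal x) = x.
Proof. exact: (is_colim_unique (colimP hX (yoneda_bideal x)) (is_colim_yoneda x)). Qed.

Lemma colim_nonexpansive (hX : J_algebra X) : nonexpansive (colim hX).
Proof.
move=> phi psi; rewrite (colimP hX phi).
apply: le_trans (qdist_triangle _ (psi : weight X) _) _.
by rewrite (is_colim_wdist0 (colimP hX psi)) adde0.
Qed.

(** * The left adjoint of the colimit describes the way below relation *)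

Section Adjoint.
Variables (hX : J_algebra X) (t : X -> bounded_ideal X).
Hypothesis adjointE : forall y phi, qdist (t y) phi = qdist y (colim hX phi).

(** Both distances between [y] and [colim (t y)] vanish: use the adjunction
    with [phi = t y] and with [phi = yoneda y]. *)
Lemma is_colim_adjoint (y : X) : is_colim (t y) y.
Proof.
suff {2}-> : y = colim hX (t y) by exact: colimP.
apply: qdist_sep; first by rewrite -adjointE qdistxx.
rewrite (colimP hX (t y)) -[LHS]/(qdist (t y) (yoneda_bideal y)).
by rewrite adjointE colim_yoneda qdistxx.
Qed.

Lemma adjoint_J_below (x y : X) : t y x = J_below hX x y.
Proof.
apply/eqP; rewrite eq_le; apply/andP; split.
  have := @le_sup_ge0 R _ [set: bounded_ideal X]
    (fun phi => tsube (phi x) (qdist y (colim hX phi))) (t y) I.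
  rewrite -adjointE qdistxx; apply: le_trans.
  by rewrite /tsube sube0 le_max lexx orbT.
apply: sup_ge0_le => [|phi _]; first exact: weight_ge0.
by rewrite tsube_le ?qdist_ge0 ?weight_ge0// addeC -adjointE wdist_le.
Qed.

(** From left to right, test [way_below a b] on the balls generating
    [t (center b)], whose join is [b]. From right to left, a directed set with
    join above [b] generates an ideal [phi] with
    [phi x <= d(center b, colim phi) + t (center b) x], so that [phi] is small
    enough at the center of [a] for some ball of the set to lie above [a]. *)
Lemma adjoint_way_below a b :
  way_below a b <-> weight_balls (t (center b)) (radius b) a.
Proof.
have g := ideal_generates (radius b) (bideal_ideal (t (center b))).
have [dE _ _ _] := g.
split.
  move=> /(_ _ b dE)[||e].
  - have := generates_supremum g (is_colim_adjoint (center b)).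
    by case: (b).
  - exact: lexx.
  rewrite /weight_balls /= => lt_e; rewrite fball_leE => ae.
  have := leeD2l (radius b)%:num%:E (weight_le (t (center b)) (center a) (center e)).
  move=> /le_lt_trans; apply; rewrite addeA.
  have -> : (radius a)%:num%:E = (radius e)%:num%:E +
      ((radius a)%:num - (radius e)%:num)%:E by rewrite -EFinD subrKC.
  by apply: le_lt_trans (leeD2l _ ae) _; rewrite lteD2rE.
rewrite /weight_balls /= => lt_a E z dE' sz.
rewrite fball_leE => bz.
have [phi [dE1 _ B _] hphi] := J_algebra_supremum hX dE' sz.
have [|e Ee ae] := B (center a) ((radius a)%:num - (radius z)%:num)%R.
  apply: le_lt_trans (wdist_le (t (center b)) phi (center a)) _.
  rewrite -[qdist _ _]/(qdist (t (center b)) phi) adjointE.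
  rewrite -(is_colim_unique hphi (colimP hX phi)).
  apply: le_lt_trans (leeD2r _ bz) _.
  move: lt_a (weight_ge0 (t (center b)) (center a)).
  case: (t _ _) => [p||]// + _.
  by rewrite -!EFinD !lte_fin; lra.
by exists e => //; rewrite fball_leE; move: ae; rewrite subrK.
Qed.

Lemma adjoint_continuous_poset : continuous_poset (formal_ball X).
Proof.
move=> b.
have -> : [set a | way_below a b] = weight_balls (t (center b)) (radius b).
  by apply/seteqP; split=> a /adjoint_way_below.
have g := ideal_generates (radius b) (bideal_ideal (t (center b))).
have [dE _ _ _] := g; split => //.
have := generates_supremum g (is_colim_adjoint (center b)).
by case: (b).
Qed.

End Adjoint.

(** * Translating radii, and the adjoint built from the way below relation *)

Definition shift h e := FormalBall (center e)
  (NngNum (addr_ge0 (ge0 (radius e)) (ge0 h))).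

Lemma shift_le h a b : (shift h a <= shift h b)%O = (a <= b)%O.
Proof. by rewrite !fball_leE /= opprD addrACA subrr addr0. Qed.

Lemma shift_surj h e :
  (h%:num <= (radius e)%:num)%R -> exists e', e = shift h e'.
Proof.
rewrite -subr_ge0 => he; exists (FormalBall (center e) (NngNum he)).
case: e he => x r /= he; congr FormalBall; apply: val_inj => /=.
by rewrite subrK.
Qed.

Lemma generates_shift E a h phi : generates E (radius (shift h a)) phi ->
  generates (shift h @^-1` E) (radius a) phi.
Proof.
move=> g; have [[[e0 Ee0] dE] A B C] := g.
have unshift e : E e -> exists2 e', (shift h @^-1` E) e' & e = shift h e'.
  move=> Ee; have [|e' ee'] := @shift_surj h e.
    apply: le_trans (generates_radius_ge g Ee).
    by rewrite /= lerDr.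
  by exists e' => //=; rewrite -ee'.
split => //.
- split; first by have [e' ? _] := unshift _ Ee0; exists e'.
  move=> e1 e2 Ee1 Ee2; have [e [Ee le1 le2]] := dE _ _ Ee1 Ee2.
  have [e' Ee' ee'] := unshift _ Ee; exists e'.
  by split => //; rewrite -(shift_le h) -ee'.
- by move=> e /A /=; rewrite opprD addrACA subrr addr0.
- move=> x c /B[e /unshift[e' Ee' ->] xe]; exists e' => //.
  by apply: le_trans xe _; rewrite lee_fin /=; lra.
Qed.

(** A directed set with join above [shift h b] may have radii below [h], so it
    cannot simply be translated back. By continuity it is enough to look at
    the balls way below [shift h b]: these have radii at least [h], and their
    translates by [- h] have join [b]. *)
Lemma way_below_shift h a b : J_algebra X -> continuous_poset (formal_ball X) ->
  way_below a b -> way_below (shift h a) (shift h b).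
Proof.
move=> hX cX ab; have [dE sE] := cX (shift h b).
have [phi g hb] := J_algebra_supremum hX dE sE.
have g' := generates_shift g; have [dE' _ _ _] := g'.
have [||e Ee ae] := ab _ b dE'.
- by have := generates_supremum g' hb; case: (b).
- exact: lexx.
move=> F z dF sF bz; have [f Ff ef] := Ee _ _ dF sF bz.
by exists f => //; apply: le_trans ef; rewrite shift_le.
Qed.

(** The ideal generated by the balls way below [(y, 0)] is the value at [y] of
    the left adjoint of the colimit. *)
Lemma continuous_poset_adjoint (hX : J_algebra X) (y : X) :
  continuous_poset (formal_ball X) ->
  exists phi, forall psi : bounded_ideal X, qdist phi psi = qdist y (colim hX psi).
Proof.
move=> cX; pose zero := NngNum (lexx (0%R : R)).
have [dE sE] := cX (FormalBall y zero).
have [phi g /= hy] := J_algebra_supremum hX dE sE.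
exists phi => psi; apply/eqP; rewrite eq_le; apply/andP; split; last first.
  (* [y] is the colimit of [phi], so this is non-expansiveness of [colim] *)
  by rewrite (is_colim_unique hy (colimP hX phi)) colim_nonexpansive.
case yc: (qdist y _) (qdist_ge0 y (colim hX psi)) => [c||]// c0; last exact: leey.
rewrite lee_fin in c0; pose h := NngNum c0.
(* the translate by [c] of [(y, 0)] lies below [(colim psi, 0)] *)
apply/(generates_wdist_leP _ g) => // e /= /(@way_below_shift h _ _ hX cX).
have gpsi := ideal_generates zero (bideal_ideal psi).
have [dpsi _ _ _] := gpsi.
move=> /(_ _ _ dpsi (generates_supremum gpsi (colimP hX psi)))[|a].
  by rewrite fball_leE /= yc add0r subr0.
rewrite /weight_balls /= add0e fball_leE /= => /ltW psia ea.
apply: le_trans (weight_le psi _ (center a)) _.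
apply: le_trans (leeD psia ea) _.
by rewrite -!EFinD lee_fin; lra.
Qed.

Lemma continuous_poset_continuous_J_algebra :
  J_algebra X -> continuous_poset (formal_ball X) -> continuous_J_algebra X.
Proof.
move=> hX cX.
have [t tE] := choice (fun y => continuous_poset_adjoint hX y cX).
exists hX, t; split => // [x y|]; last exact: colim_nonexpansive.
by rewrite tE -(is_colim_unique (is_colim_adjoint tE y) (colimP hX (t y))).
Qed.

End Algebras.

Theorem theorem5p2 (R : realType) (X : quasiMetricType R) :
  (continuous_J_algebra X <-> standard X /\ local_domain (formal_ball X)) /\
  (continuous_J_algebra X -> forall (hX : J_algebra X) (x y : X) (r s : {nonneg R}),
     way_below (FormalBall x r) (FormalBall y s) <->
     s%:num%:E + J_below hX x y < r%:num%:E).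
Proof.
split; last first.
  move=> [hX' [t [_ _ adj]]] hX x y r s.
  rewrite -(Prop_irrelevance hX hX') in adj.
  by rewrite -(adjoint_J_below adj); exact: adjoint_way_below adj _ _.
split=> [[hX [t [_ _ adj]]]|[sX [cX lX]]].
  split; first exact: J_algebra_standard.
  by split; [exact: adjoint_continuous_poset adj|exact: J_algebra_local_dcpo].
exact: continuous_poset_continuous_J_algebra (standard_J_algebra sX lX) cX.
Qed.
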